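(* Let $(q_n)$ be a sequence of positive integers with $q_n\to\infty$ and $q_n/n\to 0$ as $n\to\infty$. Let $X_i=\theta_i+\epsilon_i$, $i=1,\dots,n$, with $\epsilon_i$ i.i.d. $N(0,1)$, and for each $i$ consider testing $H_{0i}:\theta_i=0$ against $H_{1i}:\theta_i\neq 0$ with the rule $$\psi_i=\mathbf 1\Bigl\{\mathbb E(1-\kappa_i\mid X_i,\tau)>\tfrac12\Bigr\},$$ where the posterior shrinkage coefficient $\mathbb E(1-\kappa_i\mid X_i,\tau)$ (defined in the context) is computed under the one-group prior with exponent $a$ and slowly varying function $L$. Assume that $\tau=\tau_n>0$ satisfies $\tau_n\to 0$ and $n\tau_n/q_n\to C$ for some $C\in(0,\infty)$, and that $L$ satisfies (A1) and (A2) of the context. If $a>\tfrac12$, then for every $i=1,\dots,q_n$ and every $b\in\mathbb R$, $$\sup_{|\theta_i|\ge \sqrt{2\log(n/q_n)}+b}\ t_{2i}\ \longrightarrow\ 1\qquad\text{as } n\to\infty,$$ where $t_{2i}=\mathbb P_{\theta_i}\bigl(\mathbb E(1-\kappa_i\mid X_i,\tau)\le \tfrac12\bigr)$ (with $\theta_i\ne0$) is the type II error probability of $\psi_i$, i.e. the probability under $X_i\sim N(\theta_i,1)$ of not rejecting $H_{0i}$.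
   Context: One-group shrinkage prior: given $\tau>0$, independently over $i$, $\theta_i\mid\lambda_i,\tau\sim N(0,\lambda_i^2\tau^2)$ and $\lambda_i^2$ has probability density $\pi_1(t)=K\,t^{-a-1}L(t)$ on $(0,\infty)$, where $a>0$, $L:(0,\infty)\to(0,\infty)$ is measurable, continuous and slowly varying (at infinity), and $K>0$ is the normalizing constant. Here $a$ and $L$ are fixed (they do not depend on $n$). Shrinkage coefficient: $\kappa_i=1/(1+\lambda_i^2\tau^2)$, and $\mathbb E(1-\kappa_i\mid X_i,\tau)$ denotes the posterior mean of $1-\kappa_i$ given $X_i$ under this prior and $X_i\mid\theta_i\sim N(\theta_i,1)$; explicitly $$\mathbb E(1-\kappa_i\mid X_i=x,\tau)=\frac{\int_0^\infty \frac{t\tau^2}{1+t\tau^2}(1+t\tau^2)^{-1/2}e^{-x^2/(2(1+t\tau^2))}\,t^{-a-1}L(t)\,dt}{\int_0^\infty (1+t\tau^2)^{-1/2}e^{-x^2/(2(1+t\tau^2))}\,t^{-a-1}L(t)\,dt}.$$ Assumptions on $L$: (A1) there exist $c_0>0$ and $t_0>0$ such that $L(t)\ge c_0$ for all $t\ge t_0$; (A2) there exists $M\in(0,\infty)$ such that $\sup_{t\in(0,\infty)}L(t)\le M$. *)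

(* Defs.v *)
From HB Require Import structures.
From mathcomp Require Export all_boot all_order all_algebra.
From mathcomp Require Export all_classical all_reals all_analysis.
Export Order.TTheory GRing.Theory Num.Theory.
Export numFieldNormedType.Exports.

Set Implicit Arguments.
Unset Strict Implicit.
Unset Printing Implicit Defensive.

Local Open Scope classical_set_scope.
Local Open Scope ring_scope.

Definition slowly_varying (R : realType) (L : R -> R) : Prop :=
  forall c : R, 0 < c -> L (c * t) / L t @[t --> +oo] --> (1 : R).

(* L is only meaningful on (0, oo): its values elsewhere are unconstrained
   and never used. *)
Definition positive_slowly_varying (R : realType) (L : R -> R) : Prop :=
  [/\ forall t, 0 < t -> 0 < L t,
      measurable_fun (`]0, +oo[ : set R) L,
      {within (`]0, +oo[ : set R), continuous L} &
      slowly_varying L].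

(* The density, on (0, oo), of the squared local scale lambda^2. *)
Definition prior_density (R : realType) (K a : R) (L : R -> R) (t : R) : R :=
  K * t `^ (- a - 1) * L t.

Definition is_normalizing_constant (R : realType) (K a : R) (L : R -> R) :
    Prop :=
  0 < K /\
  (\int[lebesgue_measure]_(t in `]0%R, +oo[) (prior_density K a L t)%:E = 1)%E.

(* With t = lambda^2, one has kappa = 1 / (1 + t tau^2) and, marginally over
   theta, X ~ N(0, 1 + t tau^2); up to constants not depending on t, this is
   the joint density of (X, lambda^2) at (x, t), the factors K and
   (2 pi)^(-1/2) cancelling in the posterior mean. *)
Definition posterior_weight (R : realType) (a : R) (L : R -> R) (tau x t : R) :
    R :=
  (1 + t * tau ^+ 2) `^ (- 2^-1) *
  expR (- (x ^+ 2 / (2 * (1 + t * tau ^+ 2)))) *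
  t `^ (- a - 1) * L t.

(* E(1 - kappa | X = x, tau) *)
Definition shrinkage (R : realType) (a : R) (L : R -> R) (tau x : R) : R :=
  (\int[lebesgue_measure]_(t in `]0, +oo[)
     (t * tau ^+ 2 / (1 + t * tau ^+ 2) * posterior_weight a L tau x t)) /
  (\int[lebesgue_measure]_(t in `]0, +oo[) posterior_weight a L tau x t).

(* The decision psi: [true] means that the null hypothesis is rejected. *)
Definition rejects (R : realType) (a : R) (L : R -> R) (tau x : R) : bool :=
  2^-1 < shrinkage a L tau x.

Definition mutually_independent (d : measure_display) (T : measurableType d)
    (R : realType) (P : probability T R) (I : set nat)
    (X : nat -> {RV P >-> R}) : Prop :=
  forall (J : seq nat) (A : nat -> set R),
    uniq J -> [set` J] `<=` I -> (forall i, measurable (A i)) ->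
    P (\bigcap_(i in [set` J]) X i @^-1` A i) =
    (\prod_(i <- J) P (X i @^-1` A i))%E.

Definition iid_standard_normal (d : measure_display) (T : measurableType d)
    (R : realType) (P : probability T R) (I : set nat)
    (X : nat -> {RV P >-> R}) : Prop :=
  mutually_independent I X /\
  forall i, I i -> forall A : set R, measurable A ->
    distribution P (X i) A = normal_prob 0 1 A.

(* The probability of not rejecting, i.e. of E(1 - kappa | X, tau) <= 1/2, when
   X = theta + eps; this is a type II error when theta <> 0. *)
Definition type2_error (d : measure_display) (T : measurableType d)
    (R : realType) (P : probability T R) (eps : {RV P >-> R})
    (a : R) (L : R -> R) (tau theta : R) : \bar R :=
  P [set w | ~~ rejects a L tau (theta + eps w)].

(* Main.v *)
Require Import Defs.
From mathcomp Require Import measurable_realfun ring lra.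

(* Since L is bounded, the numerator of the posterior mean of 1 - kappa is at
   most a quarter of the denominator plus a tail of order tau^(2a), while the
   denominator is at least a constant times exp(-x^2/2); hence
   E(1 - kappa | x, tau) <= 1/4 + O(exp(x^2/2) tau^(2a)).  For
   |x| <= sqrt(2 log(n/q)) + B the error is
   (n/q)^(1 - 2a) exp(O(sqrt(log(n/q)))), because tau ~ C q/n, and it vanishes
   when a > 1/2.  So at theta = sqrt(2 log(n/q)) + b the null is eventually
   accepted whenever the noise lies in a fixed bounded interval, an event of
   probability as close to 1 as desired. *)

Local Open Scope classical_set_scope.
Local Open Scope ring_scope.

(** * Tail integrals of powers *)

Lemma powRN_cvg_pinfty (R : realType) (a : R) :
  0 < a -> t `^ (- a) @[t --> +oo] --> (0 : R).
Proof.
move=> a0; apply/cvgrPdist_le => e e0; near=> t.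
have t1 : e `^ (- a^-1) <= t by near: t; apply: nbhs_pinfty_ge; rewrite num_real.
have t0 : 0 < t by apply: lt_le_trans t1; rewrite powR_gt0.
rewrite sub0r normrN ger0_norm ?powR_ge0// powRN.
rewrite -[leRHS]invrK lef_pV2 ?posrE ?powR_gt0 ?invr_gt0//.
have -> : e^-1 = (e `^ (- a^-1)) `^ a.
  by rewrite -powRrM mulNr mulVf ?gt_eqF// powR_inv1// ltW.
by apply: ge0_ler_powR; rewrite ?nnegrE ?powR_ge0// ltW.
Unshelve. all: by end_near. Qed.

Lemma continuous_within_powR (R : realType) (p r : R) : 0 < r ->
  {within `[r, +oo[, continuous (fun t : R => t `^ p)}.
Proof.
move=> r0; apply: continuous_in_subspaceT => t.
rewrite inE/= in_itv/= andbT => rt.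
apply: differentiable_continuous; apply/derivable1_diffP.
by apply: ex_derive; apply: is_derive1_powR; exact: lt_le_trans rt.
Qed.

(** The antiderivative [- t^(-a) / a] vanishes at infinity because [a > 0], so only its value at [r]
    contributes. *)
Lemma integral_powR_tail (R : realType) (a r : R) : 0 < a -> 0 < r ->
  (\int[lebesgue_measure]_(t in `[r, +oo[) (t `^ (- a - 1))%:E =
   (r `^ (- a) / a)%:E)%E.
Proof.
move=> a0 r0.
have dF t : r <= t ->
    is_derive t 1 (fun t => - a^-1 * t `^ (- a)) (t `^ (- a - 1)).
  move=> rt; have ht := is_derive1_powR (- a) (lt_le_trans r0 rt).
  apply: is_derive_eq.
  by rewrite [LHS]mulrA mulrNN mulVf ?mul1r// gt_eqF.
rewrite (@ge0_continuous_FTC2y _ _ (fun t => - a^-1 * t `^ (- a)) _ 0).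
- by rewrite sub0e -EFinN mulNr opprK mulrC.
- by move=> t _; rewrite powR_ge0.
- exact: continuous_within_powR.
- by rewrite -[X in _ --> X](mulr0 (- a^-1)); apply: cvgMl_tmp; exact: powRN_cvg_pinfty.
- by move=> t rt; apply: ex_derive; apply: dF; exact: ltW.
- apply: cvg_at_right_filter.
  suff : {for r, continuous (fun t => - a^-1 * t `^ (- a))} by [].
  apply: differentiable_continuous; apply/derivable1_diffP.
  by apply: ex_derive; exact: dF.
- move=> t; rewrite in_itv/= andbT => rt.
  by rewrite derive1E; apply: derive_val; exact/dF/ltW.
Qed.

(** * The posterior weight: positivity, measurability, integrability, monotonicity *)

Section one_group.
Set Implicit Arguments.
Unset Strict Implicit.
Context (R : realType) (a K : R) (L : R -> R).
Context (ha : 0 < a) (hL : positive_slowly_varying L).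
Context (hK : is_normalizing_constant K a L).
Implicit Types c t tau x M Y : R.

Notation mu := (@lebesgue_measure R).
Notation D := (`]0%R, +oo[%classic : set R).

Let Dgt0 t : D t -> 0 < t.
Proof. by rewrite /= in_itv/= andbT. Qed.

Let L_gt0 t : D t -> 0 < L t.
Proof. by case: hL => + _ _ _ /Dgt0; exact. Qed.

Lemma posterior_weight_ge0 tau x t : D t -> 0 <= posterior_weight a L tau x t.
Proof.
by move=> /L_gt0/ltW Lt; rewrite /posterior_weight !mulr_ge0 ?powR_ge0 ?expR_ge0.
Qed.

(** Since [1 + t tau^2 >= 1], both the power [-1/2] and the Gaussian factor are at most 1. *)
Lemma posterior_weight_le tau x t : D t ->
  posterior_weight a L tau x t <= t `^ (- a - 1) * L t.
Proof.
move=> Dt; have t0 := Dgt0 Dt; have /ltW Lt := L_gt0 Dt.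
have s0 : 1 <= 1 + t * tau ^+ 2 by rewrite lerDl mulr_ge0 ?sqr_ge0// ltW.
rewrite /posterior_weight -mulrA ler_piMl ?mulr_ge0 ?powR_ge0//.
rewrite mulr_ile1 ?powR_ge0 ?expR_ge0//.
  by rewrite -[leRHS](powRr0 (1 + t * tau ^+ 2)) ler_powR// oppr_le0.
rewrite -[leRHS]expR0 ler_expR oppr_le0 divr_ge0 ?sqr_ge0// mulr_ge0//.
exact: le_trans s0.
Qed.

Lemma measurable_posterior_weight tau x :
  measurable_fun D (posterior_weight a L tau x).
Proof.
case: hL => _ mL _ _.
have ms : measurable_fun D (fun t : R => 1 + t * tau ^+ 2).
  by apply: measurable_funD => //; exact: measurable_funM.
rewrite /posterior_weight.
apply: measurable_funM => //; apply: measurable_funM; last first.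
  exact: (measurableT_comp (measurable_powR _)).
apply: measurable_funM.
  exact: (measurableT_comp (measurable_powR _)).
apply: (measurableT_comp (@measurable_expR R)).
apply: measurable_funN.
(* On [D] the base is nonnegative, so the reciprocal is the power [-1], and measurability of [powR]
   applies. *)
apply: (eq_measurable_fun (fun t : R => x ^+ 2 / 2 * (1 + t * tau ^+ 2) `^ (-1))).
  move=> t; rewrite inE => /Dgt0 t0.
  have s0 : 0 <= 1 + t * tau ^+ 2 by rewrite addr_ge0// mulr_ge0 ?sqr_ge0// ltW.
  by rewrite powR_inv1// invfM -[LHS]mulrA.
apply: measurable_funM => //.
exact: (measurableT_comp (measurable_powR _)).
Qed.

Lemma measurable_shrinkage_kernel tau :
  measurable_fun D (fun t => t * tau ^+ 2 / (1 + t * tau ^+ 2)).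
Proof.
have ms : measurable_fun D (fun t : R => t * tau ^+ 2) by exact: measurable_funM.
apply: (eq_measurable_fun
    (fun t : R => t * tau ^+ 2 * (1 + t * tau ^+ 2) `^ (-1))).
  move=> t; rewrite inE => /Dgt0 t0.
  by rewrite powR_inv1// addr_ge0// mulr_ge0 ?sqr_ge0// ltW.
apply: measurable_funM => //.
apply: (measurableT_comp (measurable_powR _)).
exact: measurable_funD.
Qed.

(** The weight is dominated by [t^(-a-1) L(t)], which is the prior density up to the factor [K],
    hence integrable. *)
Lemma integrable_posterior_weight tau x :
  mu.-integrable D (EFin \o posterior_weight a L tau x).
Proof.
have mf : measurable_fun D (fun t => t `^ (- a - 1) * L t).
  case: hL => _ mL _ _; apply: measurable_funM => //.
  exact: (measurableT_comp (measurable_powR _)).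
have : mu.-integrable D (EFin \o (fun t => t `^ (- a - 1) * L t)).
  case: hK => K0 intK; apply/integrableP; split; first exact/measurable_EFinP.
  have pos t : D t -> 0 <= t `^ (- a - 1) * L t.
    by move=> Dt; rewrite mulr_ge0 ?powR_ge0// ltW// L_gt0.
  under eq_integral.
    move=> t; rewrite inE => Dt; rewrite /= ger0_norm ?pos//.
    over.
  (* If the dominating integral were infinite, multiplying by [K > 0] would keep it infinite,
     whereas the prior has mass 1. *)
  rewrite ltNge leye_eq; apply/eqP => intoo; move: intK.
  rewrite /prior_density; under eq_integral do rewrite -mulrA EFinM.
  rewrite ge0_integralZl//=.
  2: exact/measurable_EFinP.
  2: by rewrite lee_fin ltW.
  by rewrite intoo gt0_muley.
apply: le_integrable => //.
  by apply/measurable_EFinP; exact: measurable_posterior_weight.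
move=> t Dt /=; rewrite lee_fin !ger0_norm ?posterior_weight_ge0//.
  exact: posterior_weight_le.
by rewrite mulr_ge0 ?powR_ge0// ltW// L_gt0.
Qed.

Lemma shrinkage_kernel_bounds tau t : D t ->
  0 <= t * tau ^+ 2 / (1 + t * tau ^+ 2) <= 1.
Proof.
move=> /Dgt0 t0; have s0 : 0 <= t * tau ^+ 2 by rewrite mulr_ge0 ?sqr_ge0// ltW.
by rewrite divr_ge0 ?addr_ge0//= ler_pdivrMr ?ltr_pwDl// mul1r lerDr.
Qed.

Lemma integrable_shrinkage_numerator tau x :
  mu.-integrable D (EFin \o (fun t =>
    t * tau ^+ 2 / (1 + t * tau ^+ 2) * posterior_weight a L tau x t)).
Proof.
apply: le_integrable (integrable_posterior_weight tau x) => //.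
  apply/measurable_EFinP/measurable_funM.
    exact: measurable_shrinkage_kernel.
  exact: measurable_posterior_weight.
move=> t Dt /=; have /andP[u0 u1] := shrinkage_kernel_bounds tau Dt.
rewrite lee_fin normrM ler_piMl// ger0_norm//.
Qed.

Lemma posterior_weight_homo tau x y t : D t -> `|x| <= `|y| ->
  posterior_weight a L tau y t <= posterior_weight a L tau x t.
Proof.
move=> Dt xy; have t0 := Dgt0 Dt; have /ltW Lt := L_gt0 Dt.
rewrite /posterior_weight ler_wpM2r// ler_wpM2r ?powR_ge0//.
rewrite ler_wpM2l ?powR_ge0// ler_expR lerN2 ler_wpM2r//.
  by rewrite invr_ge0 mulr_ge0// addr_ge0// mulr_ge0 ?sqr_ge0// ltW.
by rewrite -(real_normK (num_real x)) -(real_normK (num_real y)) ler_sqr ?nnegrE.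
Qed.

(** * Measurability of the posterior shrinkage in the observation *)

(** Such an [f] is a nonincreasing function composed with the absolute value. The truncation
    [Num.max 0] makes the outer function monotone on the whole line. *)
Lemma measurable_norm_antitone (f : R -> R) :
  (forall x y, `|x| <= `|y| -> f y <= f x) -> measurable_fun setT f.
Proof.
move=> fanti.
have -> : f = (fun x => f (Num.max 0 x)) \o (fun x => `|x|).
  apply/funext => x /=; apply/eqP.
  by rewrite eq_le !fanti// max_r// normr_id.
apply: measurableT_comp; last exact: normr_measurable.
apply: nonincreasing_measurable => // x y xy.
have max_ge0 z : 0 <= Num.max 0 z :> R by rewrite le_max lexx.
by apply: fanti; rewrite !ger0_norm// ge_max max_ge0 le_max xy orbT.
Qed.

(** Numerator and denominator are each nonincreasing in [|x|], because [x] enters only through the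
    Gaussian factor. This gives measurability of the two parameter integrals separately, without a
    joint measurability argument. *)
Lemma measurable_shrinkage tau : measurable_fun setT (shrinkage a L tau).
Proof.
apply: measurable_funM.
  apply: measurable_norm_antitone => x y xy; apply: le_Rintegral => //.
  - exact: integrable_shrinkage_numerator.
  - exact: integrable_shrinkage_numerator.
  - move=> t Dt; have /andP[u0 _] := shrinkage_kernel_bounds tau Dt.
    by rewrite ler_wpM2l// posterior_weight_homo.
rewrite (_ : (fun _ => _^-1) = (fun x =>
    (\int[mu]_(t in D) posterior_weight a L tau x t) `^ (-1))).
  apply: (measurableT_comp (measurable_powR _)).
  apply: measurable_norm_antitone => x y xy; apply: le_Rintegral => //.
  - exact: integrable_posterior_weight.
  - exact: integrable_posterior_weight.
  - by move=> t Dt; rewrite posterior_weight_homo.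
apply/funext => x; rewrite powR_inv1//.
by apply: Rintegral_ge0 => t Dt; exact: posterior_weight_ge0.
Qed.

(** * Bounds on the denominator and the numerator, and the acceptance criterion *)

Lemma Rintegral_ge_itv (f : R -> R) (r s k : R) : 0 < r -> r <= s ->
  mu.-integrable D (EFin \o f) -> (forall t, D t -> 0 <= f t) ->
  (forall t, r <= t <= s -> k <= f t) ->
  k * (s - r) <= \int[mu]_(t in D) f t.
Proof.
move=> r0 rs intf f0 kf.
have subD : `[r, s] `<=` D.
  by move=> t; rewrite /= !in_itv/= andbT => /andP[rt _]; exact: lt_le_trans rt.
have intf' : mu.-integrable `[r, s] (EFin \o f).
  by apply: integrableS intf.
apply: (@le_trans _ _ (\int[mu]_(t in `[r, s]) f t)).
  have -> : k * (s - r) = \int[mu]_(t in `[r, s]) k.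
    rewrite Rintegral_cst//= lebesgue_measure_itv/= lte_fin.
    by case: ltP rs => // sr rs; rewrite (@le_anti _ _ r s) ?rs// subrr !mulr0.
  apply: le_Rintegral => //.
    apply: continuous_compact_integrable; first exact: segment_compact.
    by apply: continuous_subspaceT => ?; exact: cvg_cst.
apply: fine_le; rewrite ?integrable_fin_num//.
apply: ge0_subset_integral => //.
  by case/integrableP: intf.
Qed.

(** Factor by factor: with [1 <= s = 1 + t tau^2 <= 2] one has [s^(1/2) <= s <= 2], whence the
    factor 1/2; the Gaussian factor is smallest at [s = 1], the power of [t] at [t = t0 + 1], and
    [L] is at least [c0]. *)
Lemma posterior_weight_itv_ge c0 t0 tau x t :
  0 < c0 -> 0 < t0 -> (forall t, t0 <= t -> c0 <= L t) ->
  (t0 + 1) * tau ^+ 2 <= 1 -> t0 <= t <= t0 + 1 ->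
  expR (- (x ^+ 2 / 2)) * ((t0 + 1) `^ (- a - 1) * c0 / 2) <=
  posterior_weight a L tau x t.
Proof.
move=> c00 t00 cL tau1 /andP[t0t tt0].
have t_gt0 : 0 < t by exact: lt_le_trans t0t.
have s0 : 0 <= t * tau ^+ 2 by rewrite mulr_ge0 ?sqr_ge0// ltW.
have s1 : t * tau ^+ 2 <= 1.
  by apply: le_trans tau1; rewrite ler_wpM2r ?sqr_ge0.
have -> : expR (- (x ^+ 2 / 2)) * ((t0 + 1) `^ (- a - 1) * c0 / 2) =
  2^-1 * expR (- (x ^+ 2 / 2)) * (t0 + 1) `^ (- a - 1) * c0 by ring.
rewrite /posterior_weight !ler_pM ?mulr_ge0 ?powR_ge0 ?expR_ge0 ?(ltW c00) ?cL//.
- rewrite powRN lef_pV2 ?posrE ?powR_gt0//; last by rewrite ltr_pwDl.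
  apply: (@le_trans _ _ (1 + t * tau ^+ 2)); last by rewrite -[leRHS]/(1 + 1) lerD2l.
  by apply: ler1_powR; rewrite ?lerDl// invf_le1// ler1n.
- rewrite ler_expR lerN2 ler_wpM2l ?sqr_ge0// lef_pV2 ?posrE ?mulr_gt0 ?ltr_pwDl//.
  by rewrite ler_peMr// lerDl.
- rewrite -opprD !powRN lef_pV2 ?posrE ?powR_gt0//; last by rewrite addr_gt0.
  by apply: ge0_ler_powR; rewrite ?nnegrE ?addr_ge0// ltW// addr_gt0.
Qed.

Lemma denominator_ge c0 t0 tau x :
  0 < c0 -> 0 < t0 -> (forall t, t0 <= t -> c0 <= L t) ->
  (t0 + 1) * tau ^+ 2 <= 1 ->
  expR (- (x ^+ 2 / 2)) * ((t0 + 1) `^ (- a - 1) * c0 / 2) <=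
  \int[mu]_(t in D) posterior_weight a L tau x t.
Proof.
move=> c00 t00 cL tau1.
(* The inserted factor 1 is the length of the interval from [t0] to [t0 + 1]. *)
rewrite -[leLHS]mulr1 -[X in _ * X](addrK t0 1) [1 + t0]addrC.
apply: Rintegral_ge_itv => //.
- by rewrite lerDl.
- exact: integrable_posterior_weight.
- exact: posterior_weight_ge0.
- by move=> t; exact: posterior_weight_itv_ge.
Qed.

(* Where tau^2 t < 1/3 the factor 1 - kappa is below 1/4; elsewhere the weight
   is at most M t^(-a-1). *)
Lemma numerator_le M tau x : 0 < tau -> (forall t, 0 < t -> L t <= M) ->
  \int[mu]_(t in D)
    (t * tau ^+ 2 / (1 + t * tau ^+ 2) * posterior_weight a L tau x t) <=
  4^-1 * (\int[mu]_(t in D) posterior_weight a L tau x t) +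
  M * ((3 * tau ^+ 2) `^ a / a).
Proof.
move=> tau0 LM; set r := (3 * tau ^+ 2)^-1.
have r0 : 0 < r by rewrite invr_gt0 mulr_gt0// exprn_gt0.
(* Extending the tail by zero lets all integrals run over [D], so that the integrands can be
   compared pointwise. *)
pose g : R -> R := (fun t => t `^ (- a - 1)) \_ `[r, +oo[.
have subD : `[r, +oo[ `<=` D.
  by move=> t; rewrite /= !in_itv/= !andbT => rt; exact: lt_le_trans rt.
have mp (E : set R) : measurable_fun E (fun t => t `^ (- a - 1)).
  by apply: measurable_funTS; exact: measurable_powR.
have intp : mu.-integrable `[r, +oo[ (EFin \o (fun t => t `^ (- a - 1))).
  apply/integrableP; split; first by apply/measurable_EFinP; exact: mp.
  under eq_integral do rewrite /= ger0_norm ?powR_ge0//.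
  by rewrite integral_powR_tail// ltry.
have intg : mu.-integrable D (EFin \o g).
  apply: (@integrableS _ _ _ _ setT) => //.
  rewrite /g -restrict_EFin.
  by apply: (iffLR (integrable_mkcond _ _)).
have -> : (3 * tau ^+ 2) `^ a / a = \int[mu]_(t in D) g t.
  rewrite /g -Rintegral_mkcondr setIC (setIidl subD) /Rintegral integral_powR_tail//=.
  rewrite (_ : r = (3 * tau ^+ 2) `^ (-1)); last first.
    by rewrite powR_inv1// mulr_ge0 ?sqr_ge0.
  by rewrite -powRrM mulN1r opprK.
have intw := integrable_posterior_weight tau x.
have int4w : mu.-integrable D
    (EFin \o (fun t => 4^-1 * posterior_weight a L tau x t)).
  by apply: (integrableZl _ 4^-1 intw).
have intMg : mu.-integrable D (EFin \o (fun t => M * g t)).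
  by apply: (integrableZl _ M intg).
rewrite -!RintegralZl// -RintegralD//.
apply: le_Rintegral => //.
- exact: integrable_shrinkage_numerator.
- rewrite [X in _.-integrable _ X](_ : _ = ((EFin \o (fun t => 4^-1 *
    posterior_weight a L tau x t)%R) \+ (EFin \o (fun t => M * g t)%R))%E) //.
  by apply: integrableD.
move=> t Dt; have t0 := Dgt0 Dt.
have /andP[u0 u1] := shrinkage_kernel_bounds tau Dt.
have w0 := posterior_weight_ge0 tau x Dt.
rewrite /g patchE; case: ifPn => [_|].
  apply: (@le_trans _ _ (posterior_weight a L tau x t)); first by rewrite ler_piMl.
  apply: (@le_trans _ _ (M * t `^ (- a - 1))); last by rewrite lerDr mulr_ge0.
  apply: le_trans (posterior_weight_le tau x Dt) _.
  by rewrite mulrC ler_wpM2r ?powR_ge0// LM.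
rewrite notin_setE/= in_itv/= andbT => /negP; rewrite -ltNge => tr.
rewrite mulr0 addr0 ler_wpM2r//.
have s0 : 0 <= t * tau ^+ 2 by rewrite mulr_ge0 ?sqr_ge0// ltW.
rewrite ler_pdivrMr ?ltr_pwDl//.
move: tr; rewrite /r -[_^-1]mul1r ltr_pdivlMr ?mulr_gt0 ?exprn_gt0// mulrCA.
move: s0; set s := t * _; lra.
Qed.

(** The smallness condition says exactly that the tail term [M (3 tau^2)^a / a] is at most a quarter
    of the lower bound for the denominator at [Y]. The numerator is then at most 1/4 + 1/4 of the
    denominator. The 8 is this 4 times the 2 in that lower bound. *)
Lemma not_rejects c0 t0 M tau x Y :
  0 < c0 -> 0 < t0 -> (forall t, t0 <= t -> c0 <= L t) ->
  (forall t, 0 < t -> L t <= M) ->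
  0 < tau -> (t0 + 1) * tau ^+ 2 <= 1 ->
  `|x| <= Y ->
  expR (Y ^+ 2 / 2) * (3 * tau ^+ 2) `^ a <=
    (t0 + 1) `^ (- a - 1) * c0 * a / (8 * M) ->
  ~~ rejects a L tau x.
Proof.
move=> c00 t00 cL LM tau0 tau1 xY small.
have M0 : 0 < M by apply: lt_le_trans c00 _;
  apply: le_trans (cL _ (lexx _)) (LM _ _).
have hD := denominator_ge x c00 t00 cL tau1.
have hN := numerator_le x tau0 LM.
rewrite /rejects -leNgt /shrinkage.
set DD := Rintegral _ _ _ in hD hN *.
set NN := Rintegral _ _ _ in hN *.
set c := _ * c0 / 2 in hD.
have c_gt0 : 0 < c by rewrite !mulr_gt0 ?powR_gt0// addr_gt0.
have DD0 : 0 < DD by apply: lt_le_trans hD; rewrite mulr_gt0 ?expR_gt0.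
rewrite ler_pdivrMr//.
suff : M * ((3 * tau ^+ 2) `^ a / a) <= 4^-1 * DD by move=> h; lra.
apply: (@le_trans _ _ (4^-1 * (expR (- (x ^+ 2 / 2)) * c))); last by rewrite ler_wpM2l.
apply: (@le_trans _ _ (4^-1 * (expR (- (Y ^+ 2 / 2)) * c))); last first.
  rewrite ler_wpM2l// ler_wpM2r ?(ltW c_gt0)// ler_expR lerN2 ler_wpM2r//.
  by rewrite -(real_normK (num_real x)) ler_sqr ?nnegrE// (le_trans _ xY).
rewrite expRN -ler_pdivrMl; last by rewrite invr_gt0.
rewrite ler_pdivlMl ?expR_gt0//.
move: small; rewrite ler_pdivlMr ?mulr_gt0//; set e := expR _; set p := _ `^ a.
move=> small; rewrite /c.
have -> : e * ((4^-1)^-1 * (M * (p / a))) = (e * p * (8 * M)) / a / 2.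
  by field; rewrite gt_eqF.
by rewrite ler_wpM2r// ler_pdivrMr.
Qed.

End one_group.

(** * Asymptotics of the error term *)

(** Inserting [tau <= C exp(-v^2/2)] bounds the product by a constant times
    [exp(B v - (a - 1/2) v^2)], and the quadratic term wins since [a > 1/2]. *)
Lemma posterior_exponent_small {R : realType} {a B C k : R} :
  2^-1 < a -> 0 <= B -> 0 < C -> 0 < k ->
  exists V : R, forall v tau : R, 0 <= v -> V <= v -> 0 < tau ->
    expR (v ^+ 2 / 2) * tau <= C ->
    expR ((v + B) ^+ 2 / 2) * (3 * tau ^+ 2) `^ a <= k.
Proof.
move=> a2 B0 C0 k0.
pose c := (3 * C ^+ 2) `^ a * expR (B ^+ 2 / 2).
have a0 : 0 < a by apply: lt_trans a2.
have c0 : 0 < c by rewrite mulr_gt0 ?expR_gt0 ?powR_gt0// mulr_gt0// exprn_gt0.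
pose A := ln (c / k).
have da : 0 < a - 2^-1 by rewrite subr_gt0.
(* With [k = c exp(-A)], the goal reduces to [(a - 1/2) v^2 >= B v + A]. The second entry gives
   [(a - 1/2) v >= B + |A|]; multiplying by [v] and using [v >= 1] finishes. *)
exists (Num.max 1 ((B + `|A|) / (a - 2^-1))) => v tau v0.
rewrite ge_max => /andP[v1]; rewrite ler_pdivrMr// => vA tau0 vtau.
have -> : k = c * expR (- A).
  by rewrite expRN lnK ?posrE ?divr_gt0// invf_div mulrC divfK// gt_eqF.
have tauC : tau <= C * expR (- (v ^+ 2 / 2)).
  by rewrite expRN ler_pdivlMr ?expR_gt0// mulrC.
have tau2 : 3 * tau ^+ 2 <= 3 * C ^+ 2 * expR (- v ^+ 2).
  rewrite -mulrA ler_wpM2l//.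
  have -> : - v ^+ 2 = 2%:R * - (v ^+ 2 / 2) by field.
  by rewrite expRM_natl -exprMn ler_sqr ?nnegrE ?mulr_ge0 ?expR_ge0
    ?(ltW C0) ?(ltW tau0).
have taua : (3 * tau ^+ 2) `^ a <= (3 * C ^+ 2) `^ a * expR (- v ^+ 2 * a).
  rewrite expRM -powRM ?expR_ge0 ?mulr_ge0 ?(ltW C0)//.
  by apply: ge0_ler_powR; rewrite ?nnegrE ?mulr_ge0 ?expR_ge0
    ?(ltW C0) ?(ltW tau0) ?(ltW a0).
apply: le_trans (ler_wpM2l (expR_ge0 _) taua) _.
rewrite mulrCA /c -mulrA ler_wpM2l ?powR_ge0// -!expRD ler_expR.
have Av : `|A| <= `|A| * v by rewrite ler_peMr.
have := ler_wpM2l v0 vA; have := ler_norm A.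
by rewrite !expr2; nra.
Qed.

(** For [v = sqrt(2 ln r)] one has [exp(v^2/2) = r], so the constraint on [tau] in the preceding
    lemma becomes a bound on [r tau]. *)
Lemma eventually_posterior_exponent_small {R : realType} {a B C k : R}
    {r tau : nat -> R} :
  2^-1 < a -> 0 <= B -> 0 < k -> (forall n, 0 < tau n) ->
  r n @[n --> \oo] --> +oo -> r n * tau n @[n --> \oo] --> C ->
  \forall n \near \oo,
    expR ((Num.sqrt (2 * ln (r n)) + B) ^+ 2 / 2) * (3 * tau n ^+ 2) `^ a <= k.
Proof.
move=> a2 B0 k0 tau0 roo rtau.
(* A positive bound strictly above the limit [C], so that [r n * tau n] eventually stays below
   it. *)
have C0 : 0 < `|C| + 1 by rewrite ltr_wpDl.
have [V HV] := posterior_exponent_small a2 B0 C0 k0.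
near=> n.
have rV : expR ((Num.max 0 V) ^+ 2 / 2) <= r n.
  by near: n; move/cvgryPge : roo; exact.
have r0 : 0 < r n by apply: lt_le_trans rV; exact: expR_gt0.
have lnV : (Num.max 0 V) ^+ 2 <= 2 * ln (r n).
  have : (Num.max 0 V) ^+ 2 / 2 <= ln (r n).
    by rewrite -ler_expR lnK.
  by rewrite ler_pdivrMr// mulrC.
have ln0 : 0 <= 2 * ln (r n) by apply: le_trans lnV; exact: sqr_ge0.
apply: HV => //.
- apply: (@le_trans _ _ (Num.max 0 V)); first by rewrite le_max lexx orbT.
  by rewrite -[leLHS]ger0_norm ?le_max ?lexx// -sqrtr_sqr ler_wsqrtr.
- rewrite sqr_sqrtr// [2 * _]mulrC mulfK// lnK//.
  near: n; apply: (cvgr_le C) => //.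
  by rewrite (le_lt_trans (ler_norm C))// ltrDl.
Unshelve. all: by end_near. Qed.

(** * Tightness of the normal law *)

(** Continuity from below along the intervals [[-n, n]], which increase to the whole line. *)
Lemma normal_prob_concentrated {R : realType} (m s : R) {e : R} : 0 < e ->
  exists2 B : R, 0 <= B &
    ((1 - e)%:E <= normal_prob m s [set x : R | (`|x| <= B)%R])%E.
Proof.
move=> e0; pose F (n : nat) : set R := [set x | (`|x| <= n%:R)%R].
have mF n : measurable (F n).
  rewrite (_ : F n = `[- n%:R, n%:R]%classic)//.
  by apply/seteqP; split => x; rewrite /F/= in_itv/= ler_norml.
have UF : \bigcup_n F n = setT.
  apply/seteqP; split => // x _; exists (Num.bound `|x|) => //.
  by rewrite /F/= ltW// archi_boundP.
have ndF : {homo F : n p / (n <= p)%N >-> (n <= p)%O}.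
  move=> n p np; apply/subsetPset => x; rewrite /F/= => xn.
  by rewrite (le_trans xn)// ler_nat.
have : normal_prob m s (F n) @[n --> \oo] --> 1%E.
  rewrite -(probability_setT (normal_prob m s)) -UF.
  by apply: nondecreasing_cvg_mu => //; rewrite UF.
move=> /fine_cvgP[Ffin /cvgrPdist_le].
move=> /(_ _ e0) H.
have [n [Hfin Hn]] : exists n : nat, normal_prob m s (F n) \is a fin_num /\
    `|1 - fine (normal_prob m s (F n))| <= e.
  near \oo => n; exists n; split; near: n; [exact: Ffin|exact: H].
exists n%:R => //; rewrite -[leRHS]/(normal_prob m s (F n)) -(fineK Hfin) lee_fin.
by move: Hn; rewrite ler_distl -lerBlDr => /andP[_].
Unshelve. all: by end_near. Qed.

(** * Convergence of the worst-case type II error *)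

Theorem proposition1 (R : realType) (a K : R) (L : R -> R)
    (* one-group prior *)
    (ha : 0 < a) (hL : positive_slowly_varying L)
    (hK : is_normalizing_constant K a L)
    (* (A1) and (A2) *)
    (hA1 : exists c0 t0 : R,
        [/\ 0 < c0, 0 < t0 & forall t, t0 <= t -> c0 <= L t])
    (hA2 : exists M : R, 0 < M /\ forall t, 0 < t -> L t <= M)
    (* asymptotic regime *)
    (q : nat -> nat) (tau : nat -> R) (C : R)
    (hq0 : forall n, (0 < q n)%N)
    (hqoo : q n @[n --> \oo] --> \oo)
    (hqn : ((q n)%:R / n%:R : R) @[n --> \oo] --> (0 : R))
    (htau0 : forall n, 0 < tau n)
    (htau : tau n @[n --> \oo] --> (0 : R))
    (hC : 0 < C)
    (hnC : n%:R * tau n / (q n)%:R @[n --> \oo] --> C)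
    (* noise: for each n, eps n 1, ..., eps n n are i.i.d. N(0, 1) *)
    (d : nat -> measure_display) (T : forall n, measurableType (d n))
    (P : forall n, probability (T n) R)
    (eps : forall n, nat -> {RV (P n) >-> R})
    (heps : forall n, iid_standard_normal [set i | (1 <= i <= n)%N] (eps n)) :
  2^-1 < a ->
  forall (i : nat -> nat) (hi : \forall n \near \oo, (1 <= i n <= q n)%N)
    (b : R),
  ereal_sup [set type2_error (eps n (i n)) a L (tau n) theta | theta in
      [set theta : R | theta != 0 /\
         Num.sqrt (2 * ln (n%:R / (q n)%:R)) + b <= `|theta| ]]
    @[n --> \oo] --> (1%E : \bar R).
Proof.
move=> a2 i hi b.
have [c0 [t0 [c00 t00 cL]]] := hA1.
have [M [M0 LM]] := hA2.
pose r n : R := n%:R / (q n)%:R.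
have roo : r n @[n --> \oo] --> +oo.
  apply/cvgryPge => A.
  have A0 : 0 < (`|A| + 1)^-1 by rewrite invr_gt0 ltr_wpDl.
  near=> n.
  have n0 : (0 < n)%N by near: n; exact: nbhs_infty_gt.
  have : (q n)%:R / n%:R <= (`|A| + 1)^-1.
    by near: n; apply: (cvgr_le 0).
  have r0 : 0 < r n by rewrite divr_gt0 ?ltr0n.
  rewrite -invf_div lef_pV2 ?posrE // ?ltr_wpDl//.
  by apply: le_trans; rewrite (le_trans (ler_norm A))// lerDl.
have rtau : r n * tau n @[n --> \oo] --> C.
  rewrite (_ : (fun _ => _) = (fun n => n%:R * tau n / (q n)%:R))//.
  by apply/funext => n; rewrite /r mulrAC.
pose v n := Num.sqrt (2 * ln (r n)).
have mS n (X : {RV (P n) >-> R}) theta :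
    measurable [set w | ~~ rejects a L (tau n) (theta + X w)].
  rewrite -[X in measurable X]setTI.
  have mX : measurable_fun setT (fun w => theta + X w) by exact: measurable_funD.
  have mR : measurable_fun setT (fun w => shrinkage a L (tau n) (theta + X w)).
    by apply: measurableT_comp mX; exact: (measurable_shrinkage hL hK).
  rewrite (_ : [set _ | _] =
    (fun w => shrinkage a L (tau n) (theta + X w)) @^-1` `]-oo, 2^-1]).
    exact: mR.
  by apply/seteqP; split => w; rewrite /rejects /= -leNgt in_itv.
pose S n := ereal_sup [set type2_error (eps n (i n)) a L (tau n) theta |
  theta in [set theta : R | theta != 0 /\ v n + b <= `|theta| ]].
have S_le1 n : (S n <= 1)%E.
  apply: ge_ereal_sup => _ [theta _ <-]; apply: probability_le1; exact: mS.
(* The supremum is bounded below by its value at the single signal [v n + b]. When the noise lies in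
   [[-N, N]], the observation has size at most [v n + |b| + N]. *)
have S_ge e : 0 < e -> \forall n \near \oo, ((1 - e)%:E <= S n)%E.
  move=> e0; have [N N0 HN] := normal_prob_concentrated 0 1 e0.
  have B0 : 0 <= `|b| + N by rewrite addr_ge0.
  have k0 : 0 < (t0 + 1) `^ (- a - 1) * c0 * a / (8 * M).
    by rewrite divr_gt0 ?mulr_gt0 ?powR_gt0// addr_gt0.
  have small := eventually_posterior_exponent_small a2 B0 k0 htau0 roo rtau.
  near=> n.
  (* Eventually [q n <= n], which puts the index in the range where the noise is standard normal. *)
  have inn : (1 <= i n <= n)%N.
    have /andP[-> iq] : (1 <= i n <= q n)%N by near: n; exact: hi.
    have n0 : (0 < n)%N by near: n; exact: nbhs_infty_gt.
    have : (q n)%:R / n%:R <= 1 :> R by near: n; apply: (cvgr_le 0).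
    by rewrite ler_pdivrMr ?ltr0n// mul1r ler_nat; exact: leq_trans.
  (* Positivity makes [v n + b] nonzero and equal to its absolute value, hence admissible in the
     supremum. *)
  have vb : 0 < v n + b.
    have : 1 + `|b| <= v n.
      have : expR ((1 + `|b|) ^+ 2 / 2) <= r n.
        by near: n; move/cvgryPge : roo; exact.
      move=> rb; have r0 : 0 < r n by apply: lt_le_trans rb; exact: expR_gt0.
      rewrite -[leLHS]ger0_norm ?addr_ge0// -sqrtr_sqr ler_wsqrtr//.
      by rewrite mulrC -ler_pdivrMr// -ler_expR lnK.
    by have := ler_norm (- b); rewrite normrN; lra.
  apply: (@le_trans _ _ (type2_error (eps n (i n)) a L (tau n) (v n + b))); last first.
    by apply: ereal_sup_ubound; exists (v n + b) => //=; rewrite gt_eqF// ler_norm.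
  apply: le_trans HN _.
  have mN : measurable [set x : R | `|x| <= N].
    rewrite (_ : [set _ | _] = `[- N, N]%classic)//.
    by apply/seteqP; split => x; rewrite /= in_itv/= ler_norml.
  rewrite -((heps n).2 (i n) inn _ mN).
  rewrite /type2_error; apply: (@le_measure _ _ _ (P n));
    rewrite ?inE; [|exact: mS|].
    by rewrite -[X in measurable X]setTI; exact: (measurable_funPT (eps n (i n))).
  move=> w /= wN.
  apply: (@not_rejects _ a K L ha hL hK c0 t0 M (tau n) _ (v n + (`|b| + N))) => //.
  - near: n; have : (t0 + 1) * tau n ^+ 2 @[n --> \oo] --> (t0 + 1) * (0 ^+ 2).
      by apply: cvgMl_tmp; rewrite !expr2; exact: cvgM.
    rewrite expr0n mulr0 => /cvgr_le; apply; exact: ltr01.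
  - rewrite (le_trans (ler_normD _ _))// addrA lerD//.
    rewrite (le_trans (ler_normD _ _))// lerD2r ger0_norm// sqrtr_ge0//.
  - by near: n; exact: small.
suff : S n @[n --> \oo] --> 1%E by [].
apply/fine_cvgP; split.
  near=> n; apply: fin_real.
  rewrite (le_lt_trans (S_le1 n)) ?ltry// andbT.
  (* The lower bound with [e = 1] gives [S n >= 0], which excludes minus infinity. *)
  by rewrite (@lt_le_trans _ _ (1 - 1)%:E) ?ltNyr//; near: n; exact: S_ge.
apply/cvgrPdist_le => e e0; near=> n.
have : ((1 - e)%:E <= S n)%E by near: n; exact: S_ge.
have := S_le1 n; rewrite /=; case: (S n) => [s| |] //=;
  rewrite !lee_fin ler_distl; lra.
Unshelve. all: by end_near. Qed.
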